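(* Let $a,b>2$ be integers and let $G_{a,b}$ be the grid graph with vertex set $\{1,\dots,a\}\times\{1,\dots,b\}$, two vertices being adjacent iff they differ by $1$ in exactly one coordinate and agree in the other. Then the upper traceable number of $G_{a,b}$ is $$ t^+(G_{a,b}) = \begin{cases} \dfrac{a^2b+b^2a}{2}-3, & \text{if } a,b \text{ are both even},\\[1em] \dfrac{a^2b+b^2a-a}{2}-1, & \text{if } a \text{ is even and } b \text{ is odd},\\[1em] \dfrac{a^2b+b^2a-a-b}{2}-1, & \text{if } a,b \text{ are both odd}. \end{cases} $$ (The case $a$ odd, $b$ even is obtained from the case $a$ even, $b$ odd by interchanging the roles of $a$ and $b$.)
   Context: For a connected graph $G$ on $n$ vertices with graph distance $d$, the upper traceable number $t^+(G)$ is the maximum, over all orderings $u_1,u_2,\dots,u_n$ of the vertices of $G$ (each vertex appearing exactly once), of $\sum_{i=1}^{n-1} d(u_i,u_{i+1})$. In $G_{a,b}$ the distance between $(x,y)$ and $(x',y')$ is $|x-x'|+|y-y'|$. *)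

(* Defs.v *)
From mathcomp Require Import all_boot.

Set Implicit Arguments.
Unset Strict Implicit.
Unset Printing Implicit Defensive.

(* A graph on the finite vertex set T is its adjacency relation e : rel T. *)

Definition walk_of_length (T : finType) (e : rel T) (k : nat) (x y : T) : bool :=
  [exists p : k.-tuple T, path e x p && (last x p == y)].

(* In a connected graph two vertices are always joined by a walk of length
   < #|T|, so the search bound is harmless; #|T| is returned when y is not
   reachable from x. *)
Definition graph_dist (T : finType) (e : rel T) (x y : T) : nat :=
  find (fun k => walk_of_length e k x y) (iota 0 #|T|).

Definition ordering_length (T : finType) (e : rel T) (s : seq T) : nat :=
  \sum_(uv <- zip s (behead s)) graph_dist e uv.1 uv.2.

(* [permutations (enum T)] lists the sequences in which every vertex appears
   exactly once. *)
Definition upper_traceable_number (T : finType) (e : rel T) : nat :=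
  \max_(s <- permutations (enum T)) ordering_length e s.

Definition differ_by_one (m n : nat) : bool := (m == n.+1) || (n == m.+1).

(* Vertices are indexed from 0: (i, j) stands for (i + 1, j + 1). *)
Definition grid (a b : nat) : rel ('I_a * 'I_b) :=
  fun u v => (differ_by_one u.1 v.1 && (u.2 == v.2))
          || ((u.1 == v.1) && differ_by_one u.2 v.2).
Arguments grid a b : clear implicits.

(* Main.v *)
Require Import Defs.
From mathcomp Require Import all_boot all_order all_algebra zify lra.

Import GRing.Theory Num.Theory.

(** Let [weight u] be twice the taxicab distance from [u] to the centre of the
    grid. Then [2 d(u, v) = weight u + weight v - loss u v] with [loss u v >= 0],
    and [loss u v = 0] exactly when [u] and [v] lie in opposite (closed) quadrants
    around the centre. Summed along an ordering this gives
    [2 * length = 2 * (sum of all weights) - weight(first) - weight(last) - loss],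
    so a longest ordering starts and ends near the centre and loses as little as
    possible. If both sides are even, losing nothing would confine the ordering
    to a single pair of opposite quadrants, so some loss is unavoidable. The
    extremal orderings alternate between vertices and their antipodes, one pair
    of opposite regions after another. *)

Section Ordering.
Set Implicit Arguments.
Unset Strict Implicit.
Unset Printing Implicit Defensive.
Local Open Scope nat_scope.

(** * Graph distance in the grid is taxicab distance *)

Definition taxicab (u v : nat * nat) : nat :=
  (u.1 - v.1) + (v.1 - u.1) + ((u.2 - v.2) + (v.2 - u.2)).

Definition pos (a b : nat) (u : 'I_a * 'I_b) : nat * nat := (val u.1, val u.2).

Lemma grid_taxicab a b (u v w : 'I_a * 'I_b) :
  grid a b u v -> taxicab (pos u) (pos w) <= (taxicab (pos v) (pos w)).+1.
Proof.
case: u v w => [[i1 ?] [j1 ?]] [[i2 ?] [j2 ?]] [[i3 ?] [j3 ?]].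
rewrite /grid /taxicab /differ_by_one /= -!val_eqE /=; lia.
Qed.

Lemma path_taxicab a b (p : seq ('I_a * 'I_b)) (u : 'I_a * 'I_b) :
  path (grid a b) u p -> taxicab (pos u) (pos (last u p)) <= size p.
Proof.
elim: p u => [|v p IHp] u /=; first by rewrite /taxicab; lia.
by case/andP=> /grid_taxicab uv /IHp IH; apply: leq_trans (uv _) _.
Qed.

(** The step goes towards [v], in the second coordinate only once the first ones agree; the target's
    own bounds keep it inside the grid. *)
Lemma taxicab_step a b (u v : 'I_a * 'I_b) n : taxicab (pos u) (pos v) = n.+1 ->
  exists2 u', grid a b u u' & taxicab (pos u') (pos v) = n.
Proof.
case: u v => [i j] [i' j']; rewrite /taxicab /= => duv.
have [lt_i|ge_i] := ltnP i i'.
  exists (Ordinal (leq_ltn_trans lt_i (ltn_ord i')), j); last by move=> /=; lia.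
  by rewrite /grid /differ_by_one /= !eqxx orbT.
have [gt_i|le_i] := ltnP i' i.
  have lt_i1 : i.-1 < a by have := ltn_ord i; lia.
  exists (Ordinal lt_i1, j); last by move=> /=; lia.
  by rewrite /grid /differ_by_one /= eqxx andbT; lia.
have [lt_j|ge_j] := ltnP j j'.
  exists (i, Ordinal (leq_ltn_trans lt_j (ltn_ord j'))); last by move=> /=; lia.
  by rewrite /grid /differ_by_one /= !eqxx !orbT.
have lt_j1 : j.-1 < b by have := ltn_ord j; lia.
exists (i, Ordinal lt_j1); last by move=> /=; lia.
by rewrite /grid /differ_by_one /= eqxx; lia.
Qed.

Lemma taxicab_path a b (u v : 'I_a * 'I_b) n : taxicab (pos u) (pos v) = n ->
  exists2 p, path (grid a b) u p && (last u p == v) & size p = n.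
Proof.
elim: n u => [|n IHn] u.
  move=> duv; exists [::] => //=; move: u v duv => [[i ?] [j ?]] [[i' ?] [j' ?]].
  by rewrite /taxicab xpair_eqE -!val_eqE /=; lia.
case/taxicab_step=> u' uu' /IHn[p up sz_p].
by exists (u' :: p); rewrite /= ?uu' ?sz_p.
Qed.

Lemma graph_dist_grid a b (u v : 'I_a * 'I_b) :
  graph_dist (grid a b) u v = taxicab (pos u) (pos v).
Proof.
(* The search in [graph_dist] only tries lengths below the number of vertices; it succeeds because
   [(a - 1) + (b - 1) < a * b] for positive sides. *)
have dlt : taxicab (pos u) (pos v) < #|{: 'I_a * 'I_b}|.
  rewrite card_prod !card_ord; move: u v => [[i ?] [j ?]] [[i' ?] [j' ?]].
  by rewrite /taxicab /=; nia.
rewrite /graph_dist; set d := taxicab _ _ in dlt *; set P := fun k => _.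
have Pd : P d.
  have [p up /eqP sz_p] := taxicab_path (erefl : taxicab (pos u) (pos v) = d).
  by apply/existsP; exists (Tuple sz_p).
have leP k : P k -> d <= k.
  case/existsP=> p /andP[up /eqP lastp].
  by have := path_taxicab up; rewrite size_tuple lastp.
have hasP : has P (iota 0 #|{: 'I_a * 'I_b}|).
  by apply/hasP; exists d => //; rewrite mem_iota.
have lt_find : find P (iota 0 #|{: 'I_a * 'I_b}|) < #|{: 'I_a * 'I_b}|.
  by rewrite -[X in _ < X](size_iota 0) -has_find.
apply/eqP; rewrite eqn_leq; apply/andP; split.
  rewrite leqNgt; apply/negP => /(before_find 0).
  by rewrite nth_iota // add0n Pd.
by have := leP _ (nth_find 0 hasP); rewrite nth_iota.
Qed.

(** * Weights, losses and the length identity *)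

(** Twice the distance from [i] to the midpoint [(a - 1) / 2]; doubling keeps it a natural
    number. *)
Definition offset (a i : nat) : nat := (i.*2.+1 - a) + (a - i.*2.+1).

Definition weight (a b : nat) (u : 'I_a * 'I_b) : nat :=
  offset a u.1 + offset b u.2.

(** The subtraction never truncates, by the triangle inequality through the midpoint. *)
Definition line_loss (a i j : nat) : nat :=
  offset a i + offset a j - ((i - j) + (j - i)).*2.

Definition loss (a b : nat) (u v : 'I_a * 'I_b) : nat :=
  line_loss a u.1 v.1 + line_loss b u.2 v.2.

Lemma taxicab_loss a b (u v : 'I_a * 'I_b) :
  (taxicab (pos u) (pos v)).*2 + loss u v = weight u + weight v.
Proof.
have line c i j : ((i - j) + (j - i)).*2 + line_loss c i j
    = offset c i + offset c j by rewrite /line_loss /offset; lia.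
by rewrite /loss /weight /taxicab [RHS]addnACA -!line doubleD -addnACA.
Qed.

Definition total_loss (a b : nat) (u : 'I_a * 'I_b) p : nat :=
  \sum_(uv <- zip (u :: p) p) loss uv.1 uv.2.

Lemma total_loss_cons a b (u v : 'I_a * 'I_b) p :
  total_loss u (v :: p) = loss u v + total_loss v p.
Proof. by rewrite /total_loss big_cons. Qed.

Lemma total_loss_cat a b (u : 'I_a * 'I_b) p q :
  total_loss u (p ++ q) = total_loss u p + total_loss (last u p) q.
Proof.
elim: p u => [|v p IHp] u /=; first by rewrite /total_loss /= big_nil.
by rewrite !total_loss_cons IHp addnA.
Qed.

(** An inner vertex takes part in two steps and an end in only one, so the weights of the ends must
    be added to reach the doubled sum. *)
Lemma ordering_length_grid a b (u : 'I_a * 'I_b) p :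
  (ordering_length (grid a b) (u :: p)).*2 + total_loss u p
    + (weight u + weight (last u p)) = (\sum_(v <- u :: p) weight v).*2.
Proof.
elim: p u => [|v p IHp] u.
  by rewrite /ordering_length /total_loss /= !big_nil big_seq1; lia.
move: (IHp v) (taxicab_loss u v); rewrite total_loss_cons /ordering_length /=.
by rewrite !big_cons /= graph_dist_grid; lia.
Qed.

(** Removing the two extreme positions, each of offset [a - 1], leaves the offsets of a segment of
    length [a - 2], while [a * a] drops by [4 * (a - 1)]. *)
Lemma sum_offset a : (\sum_(i < a) offset a i).*2 + odd a = a * a.
Proof.
elim/ltn_ind: a => [[|[|a]] IHa]; first by rewrite big_ord0.
  by rewrite big_ord_recl big_ord0.
rewrite big_ord_recl big_ord_recr /=.
rewrite (eq_bigr (fun i : 'I_a => offset a i)) => [|i _].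
  by move: (IHa a (ltnW (ltnSn _))); rewrite /offset /bump /= negbK; nia.
by rewrite /offset /bump /=; lia.
Qed.

Lemma sum_weight a b (s : seq ('I_a * 'I_b)) : perm_eq s (enum {: 'I_a * 'I_b}) ->
  (\sum_(v <- s) weight v).*2 + (b * odd a + a * odd b)
    = b * (a * a) + a * (b * b).
Proof.
move=> s_perm; rewrite (perm_big _ s_perm) /= big_enum /=.
rewrite big_split /= -!sum_offset.
rewrite -(pair_big xpredT xpredT (fun i j => offset a (val i))) /=.
rewrite -(pair_big xpredT xpredT (fun i j => offset b (val j))) /=.
rewrite sum_nat_const card_ord.
under eq_bigr do rewrite sum_nat_const card_ord.
by rewrite -big_distrr /= !mulnDr doubleD -!doubleMr addnACA.
Qed.

Lemma upper_traceable_grid a b k W :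
    (forall s, perm_eq s (enum {: 'I_a * 'I_b}) ->
       (ordering_length (grid a b) s).*2 + k <= W) ->
    (exists2 s, perm_eq s (enum {: 'I_a * 'I_b}) &
       (ordering_length (grid a b) s).*2 + k = W) ->
  (upper_traceable_number (grid a b)).*2 + k = W.
Proof.
move=> ub [s s_perm lbs]; apply/eqP; rewrite eqn_leq; apply/andP; split.
  rewrite /upper_traceable_number big_seq.
  apply: (big_ind (fun t => t.*2 + k <= W)).
  (* The maximum starts from 0, where the bound reads [k <= W]; this follows from the attained
     value. *)
  - by move: lbs; lia.
  - by move=> x y; lia.
  by move=> t; rewrite mem_permutations => /ub.
rewrite -lbs leq_add2r leq_double /upper_traceable_number.
by apply: leq_bigmax_seq; rewrite // mem_permutations.
Qed.

(** * Alternating with antipodes without loss *)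

Definition antipode (a b : nat) (u : 'I_a * 'I_b) : 'I_a * 'I_b :=
  (rev_ord u.1, rev_ord u.2).

Lemma antipodeK a b : involutive (@antipode a b).
Proof. by case=> i j; rewrite /antipode !rev_ordK. Qed.

Fixpoint interleave (a b : nat) (s : seq ('I_a * 'I_b)) : seq ('I_a * 'I_b) :=
  if s is u :: s' then u :: antipode u :: interleave s' else [::].

(** Reduces the check that an ordering visits every vertex once to counting [v] and its antipode in
    lists of representatives. *)
Lemma count_interleave a b (v : 'I_a * 'I_b) s :
  count_mem v (interleave s) = count_mem v s + count_mem (antipode v) s.
Proof.
elim: s => //= u s ->.
have ->: (antipode u == v) = (u == antipode v).
  by rewrite -(inj_eq (can_inj (@antipodeK a b))) antipodeK.
lia.
Qed.

Lemma last_interleave a b (u : 'I_a * 'I_b) s x :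
  last x (interleave (rcons s u)) = antipode u.
Proof. by elim: s x => //=. Qed.

(* [i] and [j] lie on opposite sides of the centre [(a - 1) / 2], which itself
   counts as being on both sides. *)
Definition opposite (a i j : nat) : bool :=
  (i.*2 < a <= j.*2.+1) || (j.*2 < a <= i.*2.+1).

Definition lossless (a b : nat) : rel ('I_a * 'I_b) :=
  fun u v => opposite a u.1 v.1 && opposite b u.2 v.2.
Arguments lossless a b : clear implicits.

(** Equality in the triangle inequality: the midpoint lies between [i] and [j]. *)
Lemma line_loss_eq0 a i j : (line_loss a i j == 0) = opposite a i j.
Proof. by rewrite /line_loss /opposite /offset; lia. Qed.

Lemma loss_eq0 a b (u v : 'I_a * 'I_b) : (loss u v == 0) = lossless a b u v.
Proof. by rewrite addn_eq0 !line_loss_eq0. Qed.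

Lemma total_loss_eq0 a b (u : 'I_a * 'I_b) p :
  (total_loss u p == 0) = path (lossless a b) u p.
Proof.
elim: p u => [|v p IHp] u; first by rewrite /total_loss big_nil.
by rewrite total_loss_cons addn_eq0 loss_eq0 IHp.
Qed.

(** One block of an extremal ordering: [P] is a region, [x] the vertex before the block and [r] what
    follows. As [s] may be empty, [r] is entered either from [x] or from the antipode of a vertex of
    the region. *)
Lemma path_interleave a b (P : pred ('I_a * 'I_b)) x s r :
    all P s ->
    (forall u, P u -> lossless a b x u) ->
    (forall u v, P u -> P v -> lossless a b u (antipode v)) ->
    (forall y, y = x \/ P (antipode y) -> path (lossless a b) y r) ->
  path (lossless a b) x (interleave s ++ r).
Proof.
move=> + xP PP; elim: s x xP => [|u s IHs] x xP /=.
  by move=> _; apply; left.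
case/andP=> Pu Ps yr; rewrite xP // PP //=; apply: IHs => //.
  (* The block continues from [antipode u], and being lossless is symmetric. *)
  move=> v Pv; have := PP v u Pv Pu.
  by rewrite /lossless /opposite; lia.
move=> y [->|Py]; apply: yr; right; first by rewrite antipodeK.
exact: Py.
Qed.

(** * Extremal orderings for the three parity cases *)

Lemma perm_eq_enum (T : finType) (s : seq T) :
  (forall v, count_mem v s = 1) -> perm_eq s (enum T).
Proof.
move=> s1; apply/allP=> v _ /=.
by rewrite s1 (count_uniq_mem _ (enum_uniq T)) mem_enum inE.
Qed.

Lemma count_enum (T : finType) (P : pred T) v : count_mem v (enum P) = P v.
Proof. by rewrite (count_uniq_mem _ (enum_uniq P)) mem_enum. Qed.

Lemma all_enum (T : finType) (P : pred T) : all P (enum P).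
Proof. by apply/allP=> v; rewrite mem_enum. Qed.

Lemma eqpos a b (u v : 'I_a * 'I_b) : (u == v) = (pos u == pos v).
Proof. by case: u v => [[i ?] [j ?]] [[i' ?] [j' ?]]. Qed.

Lemma even_even_ordering a b : 2 < a -> 2 < b -> ~~ odd a -> ~~ odd b ->
  exists2 s, perm_eq s (enum {: 'I_a * 'I_b}) &
    (ordering_length (grid a b) s).*2 + 6 + (b * odd a + a * odd b)
      = b * (a * a) + a * (b * b).
Proof.
move=> a_gt2 b_gt2 even_a even_b.
have ltp : a./2 < a by lia. have ltq : b./2 < b by lia.
have ltq1 : b.-1 < b by lia.
(* The ordering starts at the central vertex [z] and ends at the central vertex [antipode w]. The
   change of quadrant pair goes from the bottom row, at [antipode x], to the top row, at [y]. As
   [b > 2], the top row is not central, so the four vertices are distinct. *)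
pose z := (Ordinal ltp, Ordinal ltq) : 'I_a * 'I_b.
pose x := (Ordinal ltp, Ordinal ltq1) : 'I_a * 'I_b.
pose y := (rev_ord (Ordinal ltp), Ordinal ltq1) : 'I_a * 'I_b.
pose w := (rev_ord (Ordinal ltp), Ordinal ltq) : 'I_a * 'I_b.
(* NE alternates with SW, then NW with SE; only the step from [antipode x] in SW
   to [y] in NW has a loss, namely 2, as both are next to the vertical axis. *)
pose NE : pred ('I_a * 'I_b) :=
  fun u => [&& a./2 <= u.1, b./2 <= u.2, u != z & u != x].
pose NW : pred ('I_a * 'I_b) :=
  fun u => [&& u.1 < a./2, b./2 <= u.2, u != y & u != w].
pose p := antipode z :: interleave (rcons (enum NE) x).
pose q := antipode y :: interleave (rcons (enum NW) w).
have s_perm : perm_eq (z :: p ++ y :: q) (enum {: 'I_a * 'I_b}).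
  (* Conditions on the antipode of [v] become conditions on [v]; then each quadrant is checked
     separately. *)
  apply: perm_eq_enum => v; rewrite /p /q /= !(count_cat, count_interleave) /=.
  rewrite !count_interleave -!cats1 !count_cat.
  rewrite /= !count_enum /NE /NW !eqpos.
  case: v => [[i lti] [j ltj]]; rewrite /antipode /pos /= !xpair_eqE.
  have -> : (a./2 <= a - i.+1) = (i < a./2) by lia.
  have -> : (b./2 <= b - j.+1) = (j < b./2) by lia.
  have -> : (a - i.+1 < a./2) = (a./2 <= i) by lia.
  have -> : a - (a - a./2.+1).+1 = a./2 by lia.
  have -> : a - a./2.+1 = a./2.-1 by lia.
  have -> : (b - b./2.+1 == j) = (j == b./2.-1) by lia.
  have -> : (b - b.-1.+1 == j) = (j == 0) by lia.
  rewrite -!(eq_sym (a - i.+1)) -!(eq_sym (b - j.+1)).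
  have -> : (a - i.+1 == a./2) = (i == a./2.-1) by lia.
  have -> : (a - i.+1 == a./2.-1) = (i == a./2) by lia.
  have -> : (b - j.+1 == b./2) = (j == b./2.-1) by lia.
  have -> : (b - j.+1 == b.-1) = (j == 0) by lia.
  rewrite -!(eq_sym i) -!(eq_sym j).
  case: (leqP a./2 i) => hi;
    [have -> : (i == a./2.-1) = false by lia
    |have -> : (i == a./2) = false by lia];
  (case: (leqP b./2 j) => hj;
    [rewrite (_ : (j == b./2.-1) = false) 1?(_ : (j == 0) = false); try by lia
    |rewrite (_ : (j == b./2) = false) 1?(_ : (j == b.-1) = false); try by lia]);
  rewrite /= ?andbF /=; lia.
have p_path : path (lossless a b) z p.
  rewrite /p -[interleave _]cats0 /=; apply/andP; split.
    by rewrite /lossless /opposite /=; lia.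
  (* The region is the whole quadrant, so that it also contains [x], which [NE] leaves out. *)
  apply: (@path_interleave _ _ (fun u => (a./2 <= u.1) && (b./2 <= u.2))).
  - rewrite all_rcons /=; apply/andP; split; first by lia.
    by apply/allP=> v; rewrite mem_enum => /and3P[-> ->].
  - by move=> [[i lti] [j ltj]]; rewrite /lossless /opposite /=; lia.
  - move=> [[i lti] [j ltj]] [[i' lti'] [j' ltj']].
    by rewrite /lossless /opposite /=; lia.
  by [].
have q_path : path (lossless a b) y q.
  rewrite /q -[interleave _]cats0 /=; apply/andP; split.
    by rewrite /lossless /opposite /=; lia.
  apply: (@path_interleave _ _ (fun u => (u.1 < a./2) && (b./2 <= u.2))).
  - rewrite all_rcons /=; apply/andP; split; first by lia.
    by apply/allP=> v; rewrite mem_enum => /and3P[-> ->].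
  - by move=> [[i lti] [j ltj]]; rewrite /lossless /opposite /=; lia.
  - move=> [[i lti] [j ltj]] [[i' lti'] [j' ltj']].
    by rewrite /lossless /opposite /=; lia.
  by [].
exists (z :: p ++ y :: q) => //.
rewrite -(sum_weight s_perm) -ordering_length_grid.
rewrite total_loss_cat total_loss_cons.
move: p_path q_path; rewrite -!total_loss_eq0 => /eqP-> /eqP->.
rewrite /p /q last_cat !last_cons !last_interleave.
congr (_ + _); rewrite -addnA; congr (_ + _).
(* The 6 is made up of weight 2 at each end and loss 2 at the change of quadrants. *)
have centre c : 0 < c -> ~~ odd c -> offset c c./2 = 1 by rewrite /offset; lia.
have centre' c : 0 < c -> ~~ odd c -> offset c (c - c./2.+1) = 1.
  by rewrite /offset; lia.
have -> : loss (antipode x) y = 2.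
  rewrite /loss /line_loss /= centre' ?subnn //; last by lia.
  by rewrite /offset; lia.
have subK : a - (a - a./2.+1).+1 = a./2 by lia.
by rewrite /weight /= subK !(centre, centre') //; lia.
Qed.

Lemma even_odd_ordering a b : 2 < a -> 2 < b -> ~~ odd a -> odd b ->
  exists2 s, perm_eq s (enum {: 'I_a * 'I_b}) &
    (ordering_length (grid a b) s).*2 + 2 + (b * odd a + a * odd b)
      = b * (a * a) + a * (b * b).
Proof.
move=> a_gt2 b_gt2 even_a odd_b.
have ltp : a./2 < a by lia. have ltq : b./2 < b by lia.
have ltp1 : a.-1 < a by lia.
pose l := (rev_ord (Ordinal ltp), Ordinal ltq) : 'I_a * 'I_b.
pose r := (Ordinal ltp1, Ordinal ltq) : 'I_a * 'I_b.
(* NE alternates with SW and NW with SE, separated by [r] on the horizontal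
   axis; the rest of that axis comes last. Every step changes half-plane, left to
   right or back, and both ends are the vertices next to the centre. *)
pose NE : pred ('I_a * 'I_b) := fun u => (a./2 <= u.1) && (b./2 < u.2).
pose NW : pred ('I_a * 'I_b) := fun u => (u.1 < a./2) && (b./2 < u.2).
pose E : pred ('I_a * 'I_b) :=
  fun u => [&& a./2 <= u.1, u.2 == b./2 :> nat, u != r & u != antipode l].
pose p := interleave (enum NE) ++ r :: interleave (enum NW) ++ antipode r ::
  interleave (enum E) ++ [:: antipode l].
have s_perm : perm_eq (l :: p) (enum {: 'I_a * 'I_b}).
  apply: perm_eq_enum => v; rewrite /p /= !(count_cat, count_interleave) /=.
  rewrite !(count_cat, count_interleave) /= !count_cat !count_interleave.
  rewrite /= !count_enum /NE /NW /E !eqpos.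
  case: v => [[i lti] [j ltj]]; rewrite /antipode /pos /= !xpair_eqE.
  have -> : (a./2 <= a - i.+1) = (i < a./2) by lia.
  have -> : (b./2 < b - j.+1) = (j < b./2) by lia.
  have -> : (a - i.+1 < a./2) = (a./2 <= i) by lia.
  have -> : (b - j.+1 == b./2) = (j == b./2) by lia.
  have -> : (b - b./2.+1 == j) = (j == b./2) by lia.
  have -> : (b./2 == j) = (j == b./2) by lia.
  have -> : a - (a - a./2.+1).+1 = a./2 by lia.
  have -> : (a - a./2.+1 == i) = (i == a./2.-1) by lia.
  have -> : (a - a.-1.+1 == i) = (i == 0) by lia.
  have -> : (a - i.+1 == a.-1) = (i == 0) by lia.
  have -> : (a - i.+1 == a./2) = (i == a./2.-1) by lia.
  rewrite -(eq_sym i a.-1) -(eq_sym i a./2).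
  case: (leqP a./2 i) => hi; case: (ltngtP j b./2) => hj;
    rewrite ?andbF ?andbT /=; lia.
have p_path : path (lossless a b) l p.
  rewrite /p.
  apply: (@path_interleave _ _ NE); first exact: all_enum.
  - by move=> [[i lti] [j ltj]]; rewrite /NE /lossless /opposite /=; lia.
  - move=> [[i lti] [j ltj]] [[i' lti'] [j' ltj']].
    by rewrite /NE /lossless /opposite /=; lia.
  move=> y hy /=; apply/andP; split.
    case: hy => [->|]; first by rewrite /lossless /opposite /=; lia.
    move: y => [[i lti] [j ltj]].
    by rewrite /NE /lossless /opposite /=; lia.
  apply: (@path_interleave _ _ NW); first exact: all_enum.
  - by move=> [[i lti] [j ltj]]; rewrite /NW /lossless /opposite /=; lia.
  - move=> [[i lti] [j ltj]] [[i' lti'] [j' ltj']].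
    by rewrite /NW /lossless /opposite /=; lia.
  move=> {hy}y hy /=; apply/andP; split.
    case: hy => [->|]; first by rewrite /lossless /opposite /=; lia.
    move: y => [[i lti] [j ltj]].
    by rewrite /NW /lossless /opposite /=; lia.
  apply: (@path_interleave _ _ (fun u => (a./2 <= u.1) && (u.2 == b./2 :> nat))).
  - by apply/allP=> v; rewrite mem_enum => /and4P[-> ->].
  - by move=> [[i lti] [j ltj]]; rewrite /lossless /opposite /=; lia.
  - move=> [[i lti] [j ltj]] [[i' lti'] [j' ltj']].
    by rewrite /lossless /opposite /=; lia.
  move=> {hy}y hy /=; rewrite andbT.
  case: hy => [->|]; first by rewrite /lossless /opposite /=; lia.
  move: y => [[i lti] [j ltj]].
  by rewrite /lossless /opposite /=; lia.
exists (l :: p) => //; rewrite -(sum_weight s_perm) -ordering_length_grid.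
move: p_path; rewrite -total_loss_eq0 => /eqP->.
rewrite /p !(last_cat, last_cons) /=.
(* Both ends lie on the horizontal axis at offset 1, so their weights add up to 2. *)
rewrite /weight /offset /=; lia.
Qed.

Lemma odd_odd_ordering a b : 2 < a -> 2 < b -> odd a -> odd b ->
  exists2 s, perm_eq s (enum {: 'I_a * 'I_b}) &
    (ordering_length (grid a b) s).*2 + 2 + (b * odd a + a * odd b)
      = b * (a * a) + a * (b * b).
Proof.
move=> a_gt2 b_gt2 odd_a odd_b.
have ltp : a./2 < a by lia. have ltq : b./2 < b by lia.
have ltp1 : a./2.-1 < a by lia. have ltq1 : b.-1 < b by lia.
pose c := (Ordinal ltp, Ordinal ltq) : 'I_a * 'I_b.
pose n := (Ordinal ltp, Ordinal ltq1) : 'I_a * 'I_b.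
pose w := (Ordinal ltp1, Ordinal ltq) : 'I_a * 'I_b.
(* From the centre [c]: NE with SW, then SE with NW, separated by [n] on the
   vertical axis, then the rest of that axis, then the horizontal axis, ending at
   [antipode w] next to the centre. *)
pose NE : pred ('I_a * 'I_b) := fun u => (a./2 < u.1) && (b./2 < u.2).
pose SE : pred ('I_a * 'I_b) := fun u => (a./2 < u.1) && (u.2 < b./2).
pose N : pred ('I_a * 'I_b) :=
  fun u => [&& u.1 == a./2 :> nat, b./2 < u.2 & u != n].
pose W : pred ('I_a * 'I_b) :=
  fun u => [&& u.1 < a./2, u.2 == b./2 :> nat & u != w].
pose p := interleave (enum NE) ++ n :: interleave (enum SE) ++ antipode n ::
  interleave (enum N) ++ interleave (rcons (enum W) w).
have s_perm : perm_eq (c :: p) (enum {: 'I_a * 'I_b}).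
  apply: perm_eq_enum => v; rewrite /p /= !(count_cat, count_interleave) /=.
  rewrite !(count_cat, count_interleave) /= !count_cat !count_interleave.
  rewrite -!cats1 !count_cat /= !count_enum /NE /SE /N /W !eqpos.
  case: v => [[i lti] [j ltj]]; rewrite /antipode /pos /= !xpair_eqE.
  have -> : (a./2 < a - i.+1) = (i < a./2) by lia.
  have -> : (b./2 < b - j.+1) = (j < b./2) by lia.
  have -> : (b - j.+1 < b./2) = (b./2 < j) by lia.
  have -> : (a - i.+1 < a./2) = (a./2 < i) by lia.
  have -> : (a - i.+1 == a./2) = (i == a./2) by lia.
  have -> : (b - j.+1 == b./2) = (j == b./2) by lia.
  have -> : (b - j.+1 == b.-1) = (j == 0) by lia.
  have -> : (a./2 == i) = (i == a./2) by lia.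
  have -> : (b./2 == j) = (j == b./2) by lia.
  have -> : (a - a./2.+1 == i) = (i == a./2) by lia.
  by case: (ltngtP i a./2); case: (ltngtP j b./2) => /=; lia.
have p_path : path (lossless a b) c p.
  rewrite /p.
  apply: (@path_interleave _ _ NE); first exact: all_enum.
  - by move=> [[i lti] [j ltj]]; rewrite /NE /lossless /opposite /=; lia.
  - move=> [[i lti] [j ltj]] [[i' lti'] [j' ltj']].
    by rewrite /NE /lossless /opposite /=; lia.
  move=> y hy /=; apply/andP; split.
    case: hy => [->|]; first by rewrite /lossless /opposite /=; lia.
    move: y => [[i lti] [j ltj]].
    by rewrite /NE /lossless /opposite /=; lia.
  apply: (@path_interleave _ _ SE); first exact: all_enum.
  - by move=> [[i lti] [j ltj]]; rewrite /SE /lossless /opposite /=; lia.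
  - move=> [[i lti] [j ltj]] [[i' lti'] [j' ltj']].
    by rewrite /SE /lossless /opposite /=; lia.
  move=> {hy}y hy /=; apply/andP; split.
    case: hy => [->|]; first by rewrite /lossless /opposite /=; lia.
    move: y => [[i lti] [j ltj]].
    by rewrite /SE /lossless /opposite /=; lia.
  apply: (@path_interleave _ _ (fun u => (u.1 == a./2 :> nat) && (b./2 < u.2))).
  - by apply/allP=> v; rewrite mem_enum => /and3P[-> ->].
  - by move=> [[i lti] [j ltj]]; rewrite /lossless /opposite /=; lia.
  - move=> [[i lti] [j ltj]] [[i' lti'] [j' ltj']].
    by rewrite /lossless /opposite /=; lia.
  (* Passing from the vertical to the horizontal axis is lossless: in each coordinate one of the two
     vertices is central, hence opposite to everything. *)
  move=> {hy}y hy /=; rewrite -[interleave _]cats0.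
  apply: (@path_interleave _ _ (fun u => (u.1 < a./2) && (u.2 == b./2 :> nat))).
  - rewrite all_rcons /=; apply/andP; split; first by lia.
    by apply/allP=> v; rewrite mem_enum => /and3P[-> ->].
  - case: hy => [->|].
      by move=> [[i lti] [j ltj]]; rewrite /lossless /opposite /=; lia.
    move: y => [[i lti] [j ltj]] + [[i' lti'] [j' ltj']].
    by rewrite /lossless /opposite /=; lia.
  - move=> [[i lti] [j ltj]] [[i' lti'] [j' ltj']].
    by rewrite /lossless /opposite /=; lia.
  by [].
exists (c :: p) => //; rewrite -(sum_weight s_perm) -ordering_length_grid.
move: p_path; rewrite -total_loss_eq0 => /eqP->.
rewrite /p !(last_cat, last_cons) last_interleave.
(* The centre has weight 0 and its neighbour [antipode w] has weight 2. *)
rewrite /weight /offset /=; lia.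
Qed.

Lemma ordering_length_swap a b (s : seq ('I_a * 'I_b)) :
  ordering_length (grid b a) (map (fun u => (u.2, u.1)) s)
    = ordering_length (grid a b) s.
Proof.
rewrite /ordering_length; elim: s => [|u [|v s] IHs] /=; rewrite ?big_nil //.
rewrite !big_cons; congr (_ + _); last exact: IHs.
by rewrite !graph_dist_grid /taxicab /= addnC.
Qed.

Lemma perm_eq_swap a b (s : seq ('I_a * 'I_b)) :
  perm_eq s (enum {: 'I_a * 'I_b}) ->
  perm_eq (map (fun u => (u.2, u.1)) s) (enum {: 'I_b * 'I_a}).
Proof.
move=> s_perm; have swapI : injective (fun u : 'I_a * 'I_b => (u.2, u.1)).
  by move=> [i j] [i' j'] [-> ->].
apply: uniq_perm; rewrite ?enum_uniq //.
  by rewrite (map_inj_uniq swapI) (perm_uniq s_perm) enum_uniq.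
move=> [i j]; rewrite mem_enum; apply/mapP; exists (j, i) => //.
by rewrite (perm_mem s_perm) mem_enum.
Qed.

(** * Upper bounds on the length of an ordering *)

(** On an even side no position is central, so a lossless step changes side in both coordinates and
    stays in the same pair of opposite quadrants. *)
Lemma quadrant_invariant a b (u v : 'I_a * 'I_b) p : ~~ odd a -> ~~ odd b ->
  path (lossless a b) u p -> v \in u :: p ->
  (u.1 < a./2) (+) (u.2 < b./2) = (v.1 < a./2) (+) (v.2 < b./2).
Proof.
have flip c i j : ~~ odd c -> opposite c i j -> (j < c./2) = ~~ (i < c./2).
  by rewrite /opposite; lia.
move=> even_a even_b; elim: p u => [|u' p IHp] u.
  by rewrite inE => _ /eqP->.
case/andP=> /andP[uu1 uu2] /IHp IH; rewrite inE => /predU1P[-> //|/IH <-].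
by rewrite (flip _ _ _ even_a uu1) (flip _ _ _ even_b uu2) addNb addbN negbK.
Qed.

(** On an even side every offset is odd, hence at least 1. *)
Lemma weight_parity a b (u : 'I_a * 'I_b) : ~~ odd a + ~~ odd b <= weight u.
Proof. by rewrite /weight /offset; lia. Qed.

Lemma even_even_bound a b s : 0 < a -> 1 < b -> ~~ odd a -> ~~ odd b ->
  perm_eq s (enum {: 'I_a * 'I_b}) ->
  (ordering_length (grid a b) s).*2 + 6 + (b * odd a + a * odd b)
    <= b * (a * a) + a * (b * b).
Proof.
move=> a_gt0 b_gt1 even_a even_b s_perm; rewrite -(sum_weight s_perm).
have b_gt0 := ltnW b_gt1.
have ltb : b.-1 < b by lia.
have in_s v : v \in s by rewrite (perm_mem s_perm) mem_enum.
case: s in_s {s_perm} => [|u p] in_s.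
  by have := in_s (Ordinal a_gt0, Ordinal b_gt0).
rewrite leq_add2r.
move: (ordering_length_grid u p).
have w_ge2 (v : 'I_a * 'I_b) : 2 <= weight v.
  by have := weight_parity v; rewrite even_a even_b.
move: (w_ge2 u) (w_ge2 (last u p)).
have loss_gt0 : 0 < total_loss u p.
  rewrite lt0n total_loss_eq0; apply/negP => p_path.
  have inv v := quadrant_invariant even_a even_b p_path (in_s v).
  (* Two corners on a common side of the grid lie in different pairs of quadrants. *)
  have := inv (Ordinal a_gt0, Ordinal b_gt0).
  have -> := inv (Ordinal a_gt0, Ordinal ltb).
  by rewrite /=; lia.
(* Loss at least 1 and end weights at least 2 give 5, which rounds up to 6 because the doubled
   length and the doubled sum are both even. *)
move: (\sum_(v <- _) _) (ordering_length _ _) (total_loss _ _) loss_gt0.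
move: (weight _) (weight _); lia.
Qed.

Lemma weight_eq0 a b (u v : 'I_a * 'I_b) : weight u = 0 -> weight v = 0 -> u = v.
Proof.
move=> wu wv; apply/eqP; rewrite eqpos.
move: u v wu wv => [[i ?] [j ?]] [[i' ?] [j' ?]].
by rewrite /weight /offset /pos xpair_eqE /=; lia.
Qed.

Lemma odd_weight a b (u : 'I_a * 'I_b) : odd (weight u) = odd a (+) odd b.
Proof.
have odd_offset c i : odd (offset c i) = ~~ odd c by rewrite /offset; lia.
by rewrite oddD !odd_offset addNb addbN negbK.
Qed.

(** The loss is discarded; the two ends alone account for 2. *)
Lemma ordering_length_bound a b s : 0 < a -> 1 < b ->
  perm_eq s (enum {: 'I_a * 'I_b}) ->
  (ordering_length (grid a b) s).*2 + 2 + (b * odd a + a * odd b)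
    <= b * (a * a) + a * (b * b).
Proof.
move=> a_gt0 b_gt1 s_perm; rewrite -(sum_weight s_perm).
have: 1 < size s.
  by rewrite (perm_size s_perm) -cardE card_prod !card_ord; nia.
have: uniq s by rewrite (perm_uniq s_perm) enum_uniq.
case: s {s_perm} => [|u [|u' p]] // /andP[uNp _] _.
rewrite leq_add2r -ordering_length_grid; set v := last u _.
have neq_uv : u != v by apply: contraNneq uNp => ->; rewrite /v /= mem_last.
suff w_ge2 : 2 <= weight u + weight v.
  by rewrite -addnA leq_add2l; apply: leq_trans w_ge2 (leq_addl _ _).
(* The end weights have equal parity, so they add up to at least 2 unless both vanish; but only the
   centre has weight 0, and the ends are distinct. *)
have := odd_weight u; rewrite -(odd_weight v).
have [wu|] := posnP (weight u); have [wv|] := posnP (weight v); last 3 first.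
- by rewrite wu; case: (weight v) => [|[]].
- by rewrite wv; case: (weight u) => [|[]].
- by lia.
by case/eqP: neq_uv; apply: weight_eq0.
Qed.

(** * The upper traceable number, doubled and free of subtraction *)

Lemma upper_traceable_even_even a b :
    2 < a -> 2 < b -> ~~ odd a -> ~~ odd b ->
  (upper_traceable_number (grid a b)).*2 + 6 + (b * odd a + a * odd b)
    = b * (a * a) + a * (b * b).
Proof.
move=> a_gt2 b_gt2 even_a even_b; rewrite -addnA.
apply: upper_traceable_grid => [s s_perm|].
  rewrite addnA.
  exact: even_even_bound (ltnW (ltnW a_gt2)) (ltnW b_gt2) even_a even_b s_perm.
have [s s_perm len_s] := even_even_ordering a_gt2 b_gt2 even_a even_b.
by exists s; rewrite // addnA.
Qed.

Lemma upper_traceable_some_odd a b : 2 < a -> 2 < b -> odd a || odd b ->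
  (upper_traceable_number (grid a b)).*2 + 2 + (b * odd a + a * odd b)
    = b * (a * a) + a * (b * b).
Proof.
move=> a_gt2 b_gt2 odd_ab; rewrite -addnA.
apply: upper_traceable_grid => [s s_perm|].
  rewrite addnA.
  exact: ordering_length_bound (ltnW (ltnW a_gt2)) (ltnW b_gt2) s_perm.
suff [s s_perm len_s] : exists2 s, perm_eq s (enum {: 'I_a * 'I_b}) &
    (ordering_length (grid a b) s).*2 + 2 + (b * odd a + a * odd b)
      = b * (a * a) + a * (b * b) by exists s; rewrite // addnA.
case even_a: (~~ odd a).
  by apply: even_odd_ordering => //; move: odd_ab; rewrite (negPf even_a).
have odd_a := negbFE even_a.
case even_b: (~~ odd b); last exact: odd_odd_ordering (negbFE even_b).
(* For [a] odd and [b] even, the ordering of the transposed grid is reflected. *)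
have [s s_perm len_s] := even_odd_ordering b_gt2 a_gt2 even_b odd_a.
exists (map (fun u => (u.2, u.1)) s); first exact: perm_eq_swap.
by rewrite ordering_length_swap [b * _ + _]addnC len_s addnC.
Qed.

End Ordering.

(** * The closed formulas over the rationals *)

Local Open Scope ring_scope.

Theorem theorem3p1 (a b : nat) (ha : (2 < a)%N) (hb : (2 < b)%N) :
  let t : rat := (upper_traceable_number (grid a b))%:R in
  let A : rat := a%:R in
  let B : rat := b%:R in
  [/\ ~~ odd a -> ~~ odd b -> t = (A ^+ 2 * B + B ^+ 2 * A) / 2 - 3,
      ~~ odd a -> odd b -> t = (A ^+ 2 * B + B ^+ 2 * A - A) / 2 - 1,
      odd a -> ~~ odd b -> t = (A ^+ 2 * B + B ^+ 2 * A - B) / 2 - 1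
    & odd a -> odd b -> t = (A ^+ 2 * B + B ^+ 2 * A - A - B) / 2 - 1].
Proof.
(* The natural-number identity is cast to [rat], where halving and subtraction are exact; the
   parities become factors 0 or 1. *)
have rat_eq k : ((upper_traceable_number (grid a b)).*2 + k
      + (b * odd a + a * odd b) = b * (a * a) + a * (b * b))%N ->
    (upper_traceable_number (grid a b))%:R * 2 + k%:R
      + (b%:R * (odd a)%:R + a%:R * (odd b)%:R)
      = b%:R * (a%:R * a%:R) + a%:R * (b%:R * b%:R) :> rat.
  by move/(congr1 (fun n => n%:R : rat)); rewrite -muln2 !natrD !natrM.
move=> t A B; split=> pa pb.
- have := rat_eq _ (upper_traceable_even_even ha hb pa pb).
  by rewrite (negPf pa) (negPf pb) /= -/t -/A -/B; lra.
- have := rat_eq _ (upper_traceable_some_odd ha hb _).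
  by rewrite (negPf pa) pb /= -/t -/A -/B => /(_ isT); lra.
- have := rat_eq _ (upper_traceable_some_odd ha hb _).
  by rewrite pa (negPf pb) /= -/t -/A -/B => /(_ isT); lra.
- have := rat_eq _ (upper_traceable_some_odd ha hb _).
  by rewrite pa pb /= -/t -/A -/B => /(_ isT); lra.
Qed.
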